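(* Let $\beta\in(1,2)$ be such that the Bernoulli convolution $\nu_\beta$ is absolutely continuous, with $\mathcal L^1$ density $h_\beta$. For $x\in I_\beta$ with $h_\beta(x)>0$, let $m_x^1$ be the probability measure on $\mathcal E_\beta(x)$ given on cylinders by $$m_x^1[a_1\cdots a_n]=\left(\frac{\beta}{2}\right)^n\frac{h_\beta(T_{a_1\cdots a_n}(x))}{h_\beta(x)},\qquad n\in\mathbb N,\ a_1\cdots a_n\in\{0,1\}^n$$ (this is well defined for $\nu_\beta$-almost every $x$). Then $m_x^1=m_x$ for $\nu_\beta$-almost every $x\in I_\beta$, where $(m_x)$ is the disintegration of the $(\frac12,\frac12)$ Bernoulli measure $m$ along the fibres $\mathcal E_\beta(x)$.
   Context: $\Sigma=\{0,1\}^{\mathbb N}$; for a word $a_1\cdots a_n\in\{0,1\}^n$, the cylinder is $[a_1\cdots a_n]=\{\underline b\in\Sigma: b_1\cdots b_n=a_1\cdots a_n\}$. $m$ is the $(\frac12,\frac12)$ Bernoulli measure on $\Sigma$, so $m[a_1\cdots a_n]=2^{-n}$. $I_\beta=[0,\frac1{\beta-1}]$, $\pi_\beta:\Sigma\to I_\beta$, $\pi_\beta(\underline a)=\sum_{i\ge1}a_i\beta^{-i}$, and $\mathcal E_\beta(x)=\pi_\beta^{-1}(x)$ is the set of $\beta$-expansions of $x$. The Bernoulli convolution is $\nu_\beta=m\circ\pi_\beta^{-1}$. When $\nu_\beta$ is absolutely continuous with respect to Lebesgue measure, its density $h_\beta$ is extended by $0$ outside $I_\beta$. For $i\in\{0,1\}$,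 $T_i(x)=\beta x-i$, and $T_{a_1\cdots a_n}=T_{a_n}\circ\cdots\circ T_{a_1}$. The family $(m_x)$ is the $\nu_\beta$-almost everywhere unique family of probability measures such that $m_x$ is supported on $\mathcal E_\beta(x)$ and, for every integrable $f:\Sigma\to\mathbb R$, $$\int_\Sigma f\,dm=\int_{I_\beta}\int_{\mathcal E_\beta(x)}f(\underline a)\,dm_x(\underline a)\,d\nu_\beta(x).$$ *)

(* Defs.v *)
From HB Require Import structures.
From mathcomp Require Import all_boot all_order all_algebra.
From mathcomp Require Import all_classical all_reals all_analysis.

Set Implicit Arguments.
Unset Strict Implicit.
Unset Printing Implicit Defensive.

Import Order.TTheory GRing.Theory Num.Theory.
Import numFieldNormedType.Exports.

Local Open Scope classical_set_scope.
Local Open Scope ring_scope.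

(* Digit sequences are indexed from 0: the digit written a_i (i >= 1) in the
   mathematics is [a i.-1]. *)
Definition cylinder (w : seq bool) : set (nat -> bool) :=
  [set a | mkseq a (size w) = w].

(* {0,1}^N with the sigma-algebra generated by the cylinders, that is, the
   product (equivalently Borel) sigma-algebra. *)
Notation Sigma := (g_sigma_algebraType (range cylinder)).

Section bernoulli_convolution.
Context {R : realType}.
Implicit Types (beta x : R) (h : R -> R) (w : seq bool).

(* These values on cylinders determine the measure: cylinders, together with
   set0, form a pi-system generating the sigma-algebra. *)
Definition bernoulli_half (m : probability Sigma R) : Prop :=
  forall w, m (cylinder w) = (2 ^- size w)%:E.

Definition beta_interval beta : set R := `[0, (beta - 1)^-1]%classic.

Definition beta_proj beta (a : Sigma) : R :=
  limn (series (fun i => (a i)%:R * beta ^- i.+1)).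

Definition beta_expansions beta x : set Sigma := beta_proj beta @^-1` [set x].

Definition bernoulli_convolution beta (m : probability Sigma R) :
    set (measurableTypeR R) -> \bar R :=
  pushforward m (beta_proj beta : Sigma -> measurableTypeR R).

(* [h] is an arbitrary representative of the L^1 class of the density; in
   particular it is nonnegative only Lebesgue-almost everywhere. *)
Definition is_density (nu : set (measurableTypeR R) -> \bar R) h : Prop :=
  lebesgue_measure.-integrable [set: measurableTypeR R] (EFin \o h) /\
  forall A : set (measurableTypeR R), measurable A ->
    nu A = (\int[lebesgue_measure]_(x in A) (h x)%:E)%E.

Definition beta_map beta (i : bool) x : R := beta * x - i%:R.

(* T_{a_1...a_n} = T_{a_n} o ... o T_{a_1}: the first letter acts first. *)
Definition beta_map_word beta w x : R :=
  foldl (fun y i => beta_map beta i y) x w.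

(* The measures [mx x] form a probability kernel, i.e. [x |-> mx x A] is Borel
   for measurable [A], so that the iterated integrals are meaningful. The values
   of [mx] off [beta_interval beta], and on null sets, are irrelevant. *)
Definition is_disintegration beta (m : probability Sigma R)
    (mx : R.-pker (measurableTypeR R) ~> Sigma) : Prop :=
  let nu := bernoulli_convolution beta m in
  {ae nu, forall x, mx x (beta_expansions beta x) = 1%E} /\
  forall f : Sigma -> R, m.-integrable [set: Sigma] (EFin \o f) ->
    (\int[m]_a (f a)%:E =
     \int[nu]_(x in beta_interval beta)
       \int[mx x]_(a in beta_expansions beta x) (f a)%:E)%E.

Definition is_density_fibre_measure beta h x (mu : probability Sigma R) : Prop :=
  mu (beta_expansions beta x) = 1%E /\
  forall w, mu (cylinder w) =
    ((beta / 2) ^+ size w * (h (beta_map_word beta w x) / h x))%:E.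

End bernoulli_convolution.

(* Main.v *)
Require Import Defs.
From HB Require Import structures.
From mathcomp Require Import all_boot all_order all_algebra.
From mathcomp Require Import all_classical all_reals all_analysis.
From mathcomp Require Import measurable_realfun.

Import Order.TTheory GRing.Theory Num.Theory.
Import numFieldNormedType.Exports.

Local Open Scope classical_set_scope.
Local Open Scope ring_scope.

(** Write [pi] for [beta_proj beta], [nu] for the Bernoulli convolution and
    [T_w] for [beta_map_word beta w]. For a word [w] and a Borel set [B] inside
    the interval, the mass m([w] /\ pi^-1 B) can be computed in two ways.

    Through the self-similarity of [m]: the sequences in [w] are the [w b] with
    [b] arbitrary, [m] restricted to [w] is 2^-|w| times the image of [m] under
    prepending [w], and pi (w b) lies in [B] iff pi b lies in T_w B. As [nu] has
    density [h], the mass is 2^-|w| times the integral of [h] over T_w B, and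
    the substitution y = T_w x, whose Jacobian is beta^|w|, turns it into the
    integral over [B] of (beta/2)^|w| h(T_w x) dx
    ([bernoulli_cylinder_proj]; the induction on [w] handles one letter at a
    time).

    Through the disintegration, applied to the indicator of the same set: since
    [m_x] lives on the fibre over [x], the mass is the integral over [B] of
    m_x[w] dnu(x) ([disintegration_cylinder_proj]), that is, the integral over
    [B] of m_x[w] h(x) dx ([integral_density]).

    Equality for every [B] forces m_x[w] h(x) = (beta/2)^|w| h(T_w x) for almost
    every [x] ([disintegration_density]). There are countably many words, and
    [h] is positive [nu]-almost everywhere, so outside one [nu]-null set [m_x]
    has the prescribed values on all cylinders at once. Those values therefore
    come from a probability measure, namely [m_x] itself, and it is the only
    one because cylinders form a pi-system generating the sigma-algebra
    ([cylinder_measure_unique]). *)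

(** * Cylinders and the Bernoulli measure *)

Lemma cylinder_nil : cylinder [::] = setT.
Proof. by apply/seteqP; split. Qed.

Lemma measurable_cylinder (w : seq bool) : measurable (cylinder w : set Sigma).
Proof. by apply: sub_sigma_algebra; exists w. Qed.

(** Two cylinders are nested or disjoint, according to whether the shorter word
    is a prefix of the longer one; hence cylinders together with [set0] are
    stable under intersection. *)
Lemma setI_cylinder (v w : seq bool) : (size v <= size w)%N ->
  cylinder v `&` cylinder w = if take (size v) w == v then cylinder w else set0.
Proof.
move=> vw.
have takeE (a : nat -> bool) :
    mkseq a (size w) = w -> take (size v) w = mkseq a (size v).
  by move=> aw; rewrite -[w in LHS]aw /mkseq -map_take take_iota (minn_idPl vw).
apply/seteqP; split=> [a [av aw]|a].
  by rewrite (takeE a aw) av eqxx.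
by case: eqP => // wv aw; split=> //; rewrite /cylinder/= -(takeE a aw).
Qed.

Lemma cylinder_measure_unique (R : realType)
    (m1 m2 : {measure set Sigma -> \bar R}) :
  (m1 setT < +oo)%E -> (forall w, m1 (cylinder w) = m2 (cylinder w)) ->
  forall A, measurable A -> m1 A = m2 A.
Proof.
move=> m1oo m12 A mA.
pose G : set (set Sigma) := range cylinder `|` [set set0].
apply: (g_sigma_algebra_measure_unique G _ (fun=> cylinder [::])) => //.
- by move=> _ [[w _ <-]|->]; [exact: measurable_cylinder|exact: measurable0].
- by move=> _; left; exists [::].
- by rewrite cylinder_nil bigcup_const//; exists 0%N.
- suff GI v w : (size v <= size w)%N -> G (cylinder v `&` cylinder w).
    move=> _ _ [[v _ <-]|->] [[w _ <-]|->]; rewrite ?set0I ?setI0; try by right.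
    by case: (leqP (size v) (size w)) => [|/ltnW] vw; [|rewrite setIC]; exact: GI.
  by move=> /setI_cylinder ->; case: ifP => _; [left; exists w|right].
- by move=> _ [[w _ <-]|->]; [exact: m12|rewrite !measure0].
- by move=> _; rewrite cylinder_nil.
- by apply: sub_sigma_algebra2 mA => B GB; left.
Qed.

Definition prepend (i : bool) (a : Sigma) : Sigma :=
  fun n => if n is n'.+1 then a n' else i.

Lemma prepend_preimage_cylinder (i j : bool) (w : seq bool) :
  prepend i @^-1` cylinder (j :: w) = if i == j then cylinder w else set0.
Proof.
have E a : mkseq (prepend i a) (size (j :: w)) = i :: mkseq a (size w).
  by rewrite /mkseq/= (iotaDl 1 0) -map_comp.
apply/seteqP; split=> [a|a]; rewrite /cylinder/=.
  by rewrite E => -[-> aw]; rewrite eqxx.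
by case: eqP => // <- aw; rewrite E aw.
Qed.

Lemma measurable_prepend (i : bool) : measurable_fun setT (prepend i).
Proof.
apply: (@measurability _ _ Sigma Sigma setT (prepend i) (range cylinder)) => //.
move=> _ [_ [[|j w] _ <-] <-]; rewrite setTI.
  by rewrite cylinder_nil preimage_setT.
rewrite prepend_preimage_cylinder; case: ifP => _.
  exact: measurable_cylinder.
exact: measurable0.
Qed.

(** Self-similarity of the fair coin measure: conditioned on its first digit,
    the rest of the sequence has the original law. Both sides are finite
    measures in [A], so it suffices to compare them on cylinders. *)
Lemma bernoulli_prepend (R : realType) (m : probability Sigma R) (i : bool)
    (A : set Sigma) : bernoulli_half m -> measurable A ->
  m (cylinder [:: i] `&` A) = (2^-1%:E * m (prepend i @^-1` A))%E.
Proof.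
move=> hm mA.
have half0 : 0 <= 2^-1 :> R by rewrite invr_ge0.
pose m1 : {measure set Sigma -> \bar R} := mrestr m (measurable_cylinder [:: i]).
pose m2 : {measure set Sigma -> \bar R} :=
  mscale (NngNum half0) (pushforward m (prepend i)).
suff : m1 A = m2 (measurable_prepend i) A.
  by rewrite /m1 /m2/= /mrestr /mscale/= setIC.
apply: cylinder_measure_unique => //.
  by rewrite /m1/= /mrestr setTI (hm [:: i]) ltry.
move=> [|j w]; rewrite /m1 /m2/= /mrestr /mscale/= /pushforward.
  rewrite cylinder_nil preimage_setT setTI (hm [:: i]) probability_setT mule1.
  by rewrite expr1.
rewrite setIC setI_cylinder//= take0 prepend_preimage_cylinder.
rewrite eqseq_cons eqxx andbT.
rewrite [j == i]eq_sym; case: eqP => [_|_]; last by rewrite !measure0 mule0.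
by rewrite !hm -EFinM -invfM -exprS.
Qed.

Lemma bernoulli_cons (R : realType) (m : probability Sigma R) (i : bool)
    (w : seq bool) (A : set Sigma) : bernoulli_half m -> measurable A ->
  m (cylinder (i :: w) `&` A) =
  (2^-1%:E * m (cylinder w `&` prepend i @^-1` A))%E.
Proof.
move=> hm mA.
have -> : cylinder (i :: w) = cylinder [:: i] `&` cylinder (i :: w).
  by rewrite setI_cylinder//= take0 eqxx.
rewrite -setIA bernoulli_prepend//; last first.
  by apply: measurableI => //; exact: measurable_cylinder.
by rewrite preimage_setI prepend_preimage_cylinder eqxx.
Qed.

(** * The projection onto the interval *)

Section beta_projection.
Context {R : realType}.
Variables (beta : R) (beta_gt1 : 1 < beta).

Lemma is_cvg_beta_series (a : nat -> bool) :
  cvgn (series (fun i => (a i)%:R * beta ^- i.+1)).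
Proof.
have b0 : 0 < beta by exact: lt_trans ltr01 beta_gt1.
apply: (@series_le_cvg _ _ (geometric beta^-1 beta^-1)).
- by move=> n; rewrite mulr_ge0// invr_ge0 exprn_ge0// ltW.
- by move=> n /=; rewrite mulr_ge0// ?exprn_ge0// invr_ge0 ltW.
- move=> n /=; rewrite -exprS exprVn ler_piMl//.
    by rewrite invr_ge0 exprn_ge0// ltW.
  by case: (a n); rewrite ?ler01 ?lexx.
- apply: is_cvg_geometric_series.
  by rewrite gtr0_norm ?invr_gt0// invf_lt1.
Qed.

(** [T_i] undoes the prepending of the digit [i]: multiplication by [beta]
    shifts the series by one place and brings its first term to [i]. *)
Lemma beta_map_proj_prepend (i : bool) (a : Sigma) :
  beta_map beta i (beta_proj beta (prepend i a)) = beta_proj beta a.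
Proof.
have b0 : beta != 0 by rewrite gt_eqF// (lt_trans ltr01 beta_gt1).
apply/esym/cvg_lim => //.
have -> : series (fun n => (a n)%:R * beta ^- n.+1) =
    (fun n => beta * series (fun n => (prepend i a n)%:R * beta ^- n.+1) n.+1
              - i%:R).
  apply/funext => n; rewrite /series/= big_nat_recl//= mulrDr expr1 mulrCA divff//.
  rewrite mulr1 addrAC subrr add0r mulr_sumr; apply: eq_bigr => k _.
  by rewrite [in RHS]exprS invfM [RHS]mulrCA mulVKf.
apply: cvgB; last exact: cvg_cst.
apply: cvgMl_tmp; rewrite cvg_shiftS; exact: is_cvg_beta_series.
Qed.

Lemma measurable_digit (n : nat) : measurable [set a : Sigma | a n].
Proof.
have -> : [set a : Sigma | a n] =
    \bigcup_(w : seq bool) (if size w == n.+1 then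
       if nth false w n then cylinder w else set0 else set0).
  apply/seteqP; split=> [a an|a [w _]].
    exists (mkseq a n.+1) => //.
    by rewrite size_mkseq eqxx nth_mkseq// ifT//= /cylinder /mkset size_mkseq.
  case: eqP => // wn; case: ifP => // + aw; rewrite -aw nth_mkseq//.
  by rewrite wn.
apply: countable_bigcupT_measurable => // w.
by case: ifP => _; [case: ifP => _|]; [exact: measurable_cylinder|exact: measurable0..].
Qed.

Lemma measurable_beta_proj :
  measurable_fun setT (beta_proj beta : Sigma -> measurableTypeR R).
Proof.
apply: (@measurable_fun_cvg _ _ _ _
    (fun n (a : Sigma) => series (fun i => (a i)%:R * beta ^- i.+1) n)).
  move=> n; apply: measurable_sum => i; apply: measurable_funM => //.
  have -> : (fun a : Sigma => (a i)%:R : R) = \1_[set a : Sigma | a i].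
    by apply/funext => a; rewrite indicE; congr (nat_of_bool _)%:R; rewrite mem_setE.
  by apply: measurable_indic; exact: measurable_digit.
by move=> a _; exact: is_cvg_beta_series.
Qed.

(** A push-forward is a measure only once the map is known to be measurable;
    packing it as a probability gives access to the theory of measures, the
    equation of functions to the facts stated about the bare push-forward. *)
Lemma bernoulli_convolution_probability (m : probability Sigma R) :
  exists nu : probability (measurableTypeR R) R,
    nu = bernoulli_convolution beta m :> (set (measurableTypeR R) -> \bar R).
Proof.
pose X : {mfun Sigma >-> measurableTypeR R} :=
  HB.pack (beta_proj beta : Sigma -> measurableTypeR R)
    (isMeasurableFun.Build _ _ _ _ _ measurable_beta_proj).
by exists (distribution m X).
Qed.

End beta_projection.

(** * Affine substitutions for the Lebesgue measure *)

Section affine_substitution.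
Context {R : realType}.
Variables (c d : R) (c_gt0 : 0 < c).

Local Notation mu := (@lebesgue_measure R).
Let phi (x : measurableTypeR R) : measurableTypeR R := c * x + d.

Lemma measurable_affine : measurable_fun setT phi.
Proof. by apply: measurable_funD => //; apply: measurable_funM. Qed.

Lemma measurable_affine_preimage A : measurable A -> measurable (phi @^-1` A).
Proof. by move=> mA; rewrite -[X in measurable X]setTI; exact: measurable_affine. Qed.

(** It is enough to look at half-open intervals, where the preimage of
    ]a, b] is ](a - d) / c, (b - d) / c]. *)
Lemma lebesgue_measure_affine A : measurable A ->
  mu A = (c%:E * mu (phi @^-1` A))%E.
Proof.
move=> mA.
pose m : {measure set (measurableTypeR R) -> \bar R} :=
  mscale (NngNum (ltW c_gt0)) (pushforward mu phi).
suff : mu A = m measurable_affine A by [].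
apply: lebesgue_measure_unique => // _ [[a b] _ <-].
rewrite /m/= /mscale/= /pushforward.
have -> : phi @^-1` `]a, b] = `](a - d) / c, (b - d) / c]%classic.
  apply/seteqP; split=> x /=; rewrite !in_itv/= ltr_pdivrMr// ler_pdivlMr//;
    by rewrite ltrBlDr lerBrDr mulrC.
rewrite !lebesgue_measure_itv/= !lte_fin ltr_pM2r ?invr_gt0// ltrD2r.
case: ifP => _; last by rewrite mule0.
by rewrite -!EFinB -EFinM -mulrBl opprB addrA subrK mulrC divfK// gt_eqF.
Qed.

Lemma ge0_integral_affine A (f : R -> \bar R) : measurable A ->
  measurable_fun setT f -> (forall x, 0 <= f x)%E ->
  (\int[mu]_(x in A) f x = c%:E * \int[mu]_(x in phi @^-1` A) f (phi x))%E.
Proof.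
move=> mA mf f0.
have mfA : measurable_fun A f by exact: measurable_funTS.
pose k := NngNum (ltW c_gt0).
pose p : {measure set (measurableTypeR R) -> \bar R} := pushforward mu phi.
transitivity (\int[mscale k (p measurable_affine)]_(x in A) f x)%E.
  apply: eq_measure_integral => B mB _; rewrite /mscale/= /pushforward.
  exact: lebesgue_measure_affine.
rewrite ge0_integral_mscale//=.
by rewrite /p ge0_integral_pushforward//; exact: measurable_affine.
Qed.

Lemma integrable_affine (f : R -> \bar R) :
  mu.-integrable setT f -> mu.-integrable setT (f \o phi).
Proof.
move=> /integrableP[mf foo]; apply/integrableP; split.
  by apply: measurableT_comp => //; exact: measurable_affine.
move: foo; rewrite ge0_integral_affine//; last exact: measurableT_comp.
rewrite preimage_setT !ltey.
by apply: contra_neq => ->; rewrite gt0_muley// lte_fin.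
Qed.

Lemma integral_affine A (f : R -> \bar R) : measurable A ->
  mu.-integrable setT f ->
  (\int[mu]_(x in A) f x = c%:E * \int[mu]_(x in phi @^-1` A) f (phi x))%E.
Proof.
move=> mA fi; have mf := measurable_int _ fi.
have mphiA := measurable_affine_preimage _ mA.
have fphi : mu.-integrable (phi @^-1` A) (f \o phi).
  by apply: (integrableS measurableT) => //; exact: integrable_affine.
rewrite [LHS]integralE [in RHS]integralE muleBr//; last first.
  by rewrite fin_num_adde_defl// fin_numN integrable_neg_fin_num.
congr (_ - _)%E.
  rewrite (funepos_comp f phi : (fun x => f (phi x))^\+%E = _).
  by rewrite ge0_integral_affine//; exact: measurable_funepos.
rewrite (funeneg_comp f phi : (fun x => f (phi x))^\-%E = _).
by rewrite ge0_integral_affine//; exact: measurable_funeneg.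
Qed.

End affine_substitution.

(** * Probability kernels and densities *)

Lemma probability_setI1 d (T : measurableType d) (R : realType)
    (P : probability T R) (A E : set T) : measurable A -> measurable E ->
  P E = 1%E -> P (A `&` E) = P A.
Proof.
move=> mA mE PE1; have PCE : P (~` E) = 0%E.
  by rewrite probability_setC// PE1 subee.
rewrite -[in RHS](setIT A) -(setUv E) setIUr measureU//; last 3 first.
- exact: measurableI.
- by apply: measurableI => //; exact: measurableC.
- by rewrite setIACA setICr setI0.
have mAC : measurable (A `&` ~` E) by apply: measurableI => //; exact: measurableC.
rewrite [X in (_ + X)%E](_ : _ = 0%E) ?adde0//.
apply/eqP; rewrite eq_le measure_ge0 andbT -PCE le_measure ?inE//.
exact: measurableC.
Qed.

Section kernel_measures.
Context d d' (X : measurableType d) (Y : measurableType d') (R : realType).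
Variables (k : R.-pker X ~> Y) (x : X).

(** The kernel structure gives [k x] total mass 1 but not the structure of a
    probability measure; this alias carries it. *)
Definition kernel_measure : set Y -> \bar R := k x.

HB.instance Definition _ := Measure.on kernel_measure.

HB.instance Definition _ :=
  Measure_isProbability.Build _ _ _ kernel_measure (prob_kernel x).

Lemma kernel_probability :
  exists P : probability Y R, forall A, P A = k x A.
Proof. by exists kernel_measure. Qed.

End kernel_measures.

(** The density [h] agrees [mu]-almost everywhere with the Radon-Nikodym
    derivative, for which the formula is known. *)
Lemma integral_density d (T : measurableType d) (R : realType)
    (nu : {finite_measure set T -> \bar R})
    (mu : {sigma_finite_measure set T -> \bar R}) (h : T -> R) :
  mu.-integrable setT (EFin \o h) ->
  (forall A, measurable A -> nu A = \int[mu]_(x in A) (h x)%:E)%E ->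
  forall E g, measurable E -> nu.-integrable E g ->
  (\int[nu]_(x in E) g x = \int[mu]_(x in E) (g x * (h x)%:E))%E.
Proof.
move=> ih nuE E g mE ig.
have numu : nu `<< mu.
  apply/null_content_dominatesP => A mA muA0.
  by rewrite nuE// null_set_integral//; exact: measurable_funTS (measurable_int _ ih).
have mg := measurable_int _ ig.
rewrite -(Radon_Nikodym_change_of_variables numu mE ig).
have mRN : measurable_fun E (Radon_Nikodym (charge_of_finite_measure nu) mu).
  apply: measurable_funTS; apply: (measurable_int mu); exact: Radon_Nikodym_integrable.
have mh : measurable_fun E (EFin \o h).
  by apply: measurable_funTS; exact: measurable_int _ ih.
apply: ae_eq_integral => //; [exact: emeasurable_funM|exact: emeasurable_funM|].
apply: ae_eqe_mul2l; apply: integral_ae_eq => //.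
  by apply: (integrableS measurableT) => //; exact: Radon_Nikodym_integrable.
by move=> A AE mA; rewrite -Radon_Nikodym_integral//= -nuE.
Qed.

(** * Computing the mass of a cylinder over a Borel set in two ways *)

Section density.
Context {R : realType}.
Variables (beta : R) (beta_gt1 : 1 < beta).
Variables (m : probability Sigma R) (hm : bernoulli_half m).
Variables (h : R -> R) (hh : is_density (bernoulli_convolution beta m) h).

Local Notation mu := (@lebesgue_measure R).

Let beta_gt0 : 0 < beta. Proof. exact: lt_trans beta_gt1. Qed.

Lemma integrable_beta_map_word w :
  mu.-integrable setT (fun x => (h (beta_map_word beta w x))%:E).
Proof.
elim: w => [|i w IH]; first exact: hh.1.
exact: (integrable_affine beta (- i%:R) beta_gt0 _ IH).
Qed.

(** One letter is peeled off at a time: self-similarity of [m] contributes the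
    factor 1/2, and the substitution y = T_i x the factor [beta]. *)
Lemma bernoulli_cylinder_proj w (B : set (measurableTypeR R)) : measurable B ->
  (m (cylinder w `&` beta_proj beta @^-1` B) =
   \int[mu]_(x in B) ((beta / 2) ^+ size w * h (beta_map_word beta w x))%:E)%E.
Proof.
elim: w B => [|i w IH] B mB.
  rewrite cylinder_nil setTI; under eq_integral do rewrite expr0 mul1r.
  exact: (hh.2 B mB).
(* The inverse branch of [T_i], which prepending [i] induces on the interval. *)
pose S (y : measurableTypeR R) : measurableTypeR R := beta^-1 * y + beta^-1 * i%:R.
have TK x : S (beta_map beta i x) = x.
  by rewrite /S /beta_map -mulrDr subrK mulKf// gt_eqF.
have mS : measurable (S @^-1` B) by exact: measurable_affine_preimage.
rewrite bernoulli_cons//; last first.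
  by rewrite -[X in measurable X]setTI; exact: measurable_beta_proj.
have -> : prepend i @^-1` (beta_proj beta @^-1` B) =
    beta_proj beta @^-1` (S @^-1` B).
  have E a : beta_proj beta (prepend i a) = S (beta_proj beta a).
    by rewrite -(beta_map_proj_prepend _ beta_gt1 i a) TK.
  by apply/seteqP; split=> a; rewrite /preimage /mkset E.
rewrite IH//.
rewrite (integral_affine beta (- i%:R) beta_gt0) //; last first.
  under eq_fun do rewrite EFinM.
  by apply: integrableZl => //; exact: integrable_beta_map_word.
have -> : (fun x : measurableTypeR R => beta * x - i%:R : measurableTypeR R)
    @^-1` (S @^-1` B) = B.
  by apply/seteqP; split=> x /=; rewrite TK.
rewrite muleA -EFinM mulrC -integralZl//; last first.
  under eq_fun do rewrite EFinM.
  apply: integrableZl => //; apply: (integrableS measurableT) => //.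
  exact: (integrable_beta_map_word (i :: w)).
apply: eq_integral => x _ /=.
by rewrite -EFinM mulrA -exprS.
Qed.

(** The set where [h <= 0] has [nu]-measure equal to the integral of [h] over
    it, which is at most 0. *)
Lemma bernoulli_convolution_gt0 :
  {ae bernoulli_convolution beta m, forall x, 0 < h x}.
Proof.
have [nu nuE] := bernoulli_convolution_probability _ beta_gt1 m.
rewrite -nuE.
have mh : measurable_fun setT (EFin \o h) by exact: measurable_int hh.1.
have mN : measurable (~` [set x : measurableTypeR R | 0 < h x]).
  apply: measurableC; rewrite -[X in measurable X]setTI.
  rewrite (_ : [set x | _] = [set x | (0 < (h x)%:E)%E]); last first.
    by apply/seteqP; split=> x /=; rewrite lte_fin.
  by apply: measurable_lte => //; exact: measurable_cst.
apply/negligibleP => //; apply/eqP; rewrite -measure_le0.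
apply: (@le_trans _ _ (bernoulli_convolution beta m (~` [set x | 0 < h x]))).
  by rewrite -nuE.
have hN x : (~` [set x | 0 < h x]) x -> (0 <= (- h x)%:E)%E.
  by move=> /= /negP; rewrite -leNgt lee_fin oppr_ge0.
rewrite (hh.2 _ mN); under eq_integral do rewrite -[h _]opprK EFinN.
by rewrite integral_ge0N// oppe_le0 integral_ge0.
Qed.

Variables (mx : R.-pker (measurableTypeR R) ~> Sigma)
  (hmx : is_disintegration beta m mx).

(** The fibre depends on [x], so measurability of the kernel is not enough:
    the intersection of [C] with the fibre is the section at [x] of a measurable
    subset of the product, the part of the graph of the projection over [C]. *)
Lemma measurable_kernel_beta_expansions (C : set Sigma) : measurable C ->
  measurable_fun setT (fun x => mx x (C `&` beta_expansions beta x)).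
Proof.
move=> mC.
pose D : set (measurableTypeR R * Sigma) :=
  [set p | beta_proj beta p.2 = p.1] `&` [set p | C p.2].
have mD : measurable D.
  apply: measurableI; rewrite -[X in measurable X]setTI.
    rewrite (_ : [set p | _] = [set p | (beta_proj beta p.2)%:E = p.1%:E :> \bar R]).
      apply: measurable_eqe => //; apply: measurableT_comp => //.
      by apply: measurableT_comp => //; exact: measurable_beta_proj.
    by apply/seteqP; split=> p /=; [move=> ->|case].
  exact: measurable_snd.
have -> : (fun x => mx x (C `&` beta_expansions beta x)) =
    (fun x => mx x (xsection D x)).
  apply/funext => x; congr (mx x _); apply/seteqP.
  by split=> a; rewrite /xsection/= inE => -[].
by apply: measurable_fun_xsection_finite_kernel; rewrite inE.
Qed.

(** The disintegration formula for the indicator of [w] /\ pi^-1 B. On the fibre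
    over [x] the condition pi a \in B just says [x \in B], and the fibre has
    full [m_x]-measure, so the inner integral is m_x[w] or 0. *)
Lemma disintegration_cylinder_proj w (B : set (measurableTypeR R)) :
  measurable B -> B `<=` beta_interval beta ->
  (m (cylinder w `&` beta_proj beta @^-1` B) =
   \int[bernoulli_convolution beta m]_(x in B) mx x (cylinder w))%E.
Proof.
move=> mB BI.
have [nu nuE] := bernoulli_convolution_probability _ beta_gt1 m.
set C : set Sigma := _ `&` _.
have mpi : measurable_fun setT (beta_proj beta : Sigma -> measurableTypeR R).
  exact: measurable_beta_proj.
have mC : measurable C.
  apply: measurableI; first exact: measurable_cylinder.
  by rewrite -[X in measurable X]setTI; exact: mpi.
have mE x : measurable (beta_expansions beta x).
  by rewrite /beta_expansions -[X in measurable X]setTI; apply: mpi => //.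
have mI : measurable (beta_interval beta : set (measurableTypeR R)).
  exact: measurable_itv.
have [] := hmx; rewrite -nuE => supp /(_ (\1_C)) dis.
have -> : m C = (\int[m]_a (\1_C a)%:E)%E by rewrite integral_indic// setIT.
rewrite dis; last exact: integrable_indic.
under eq_integral do rewrite integral_indic//.
have -> : B = beta_interval beta `&` B by rewrite setIidr.
rewrite integral_mkcondr; apply: ge0_ae_eq_integral => //.
- by apply: measurable_funTS; exact: measurable_kernel_beta_expansions.
- apply/measurable_restrict => //; apply: measurable_funTS.
  by apply: measurable_kernel; exact: measurable_cylinder.
- by move=> x _; apply: erestrict_ge0.
apply: (@filterS _ _ (ae_filter_ringOfSetsType nu) _ _ _ supp) => x mx1 _.
rewrite patchE; case: ifPn => xB.
  have -> : C `&` beta_expansions beta x = cylinder w `&` beta_expansions beta x.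
    apply/seteqP; split=> a [].
      by move=> [].
    by move=> wa ax; split=> //; split=> //=; rewrite ax; exact/set_mem.
  have [P PE] := kernel_probability _ _ _ _ _ mx x; rewrite -!PE.
  by apply: probability_setI1; rewrite ?PE//; exact: measurable_cylinder.
rewrite (_ : _ `&` _ = set0) ?measure0//.
apply/seteqP; split=> // a [[_ /=]] + ax; rewrite ax => /mem_set xB'.
by rewrite xB' in xB.
Qed.

(** Both sides have the same integral over every Borel subset of the interval,
    namely the mass of the cylinder over that subset. *)
Lemma disintegration_density w :
  {ae mu, forall x, beta_interval beta x ->
    (mx x (cylinder w) * (h x)%:E)%E =
    ((beta / 2) ^+ size w * h (beta_map_word beta w x))%:E}.
Proof.
have [nu nuE] := bernoulli_convolution_probability _ beta_gt1 m.
have mI : measurable (beta_interval beta : set (measurableTypeR R)).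
  exact: measurable_itv.
apply: ae_eq_sym; apply: integral_ae_eq => //.
- apply: (integrableS measurableT) => //.
  under eq_fun do rewrite EFinM.
  by apply: integrableZl => //; exact: integrable_beta_map_word.
- apply: measurable_funTS; apply: emeasurable_funM.
    by apply: measurable_kernel; exact: measurable_cylinder.
  exact: measurable_int hh.1.
move=> B BI mB; rewrite -bernoulli_cylinder_proj// disintegration_cylinder_proj//.
rewrite -nuE; apply: integral_density => //.
- exact: hh.1.
- by move=> A mA; rewrite -(hh.2 A mA) -nuE.
apply: (integrableS measurableT) => //; apply/integrableP; split.
  by apply: measurable_kernel; exact: measurable_cylinder.
apply: (@le_lt_trans _ _ (\int[nu]_x 1)%E); last first.
  rewrite integral_cst// mul1e.
  by rewrite (le_lt_trans (probability_le1 nu measurableT))// ltry.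
apply: ge0_le_integral => //.
  apply: measurableT_comp => //.
  by apply: measurable_kernel; exact: measurable_cylinder.
move=> x _; rewrite gee0_abs//.
have [P PE] := kernel_probability _ _ _ _ _ mx x; rewrite -PE.
by apply: probability_le1; exact: measurable_cylinder.
Qed.

End density.

(** * The fibre measures *)

Theorem proposition3p1 (R : realType) (beta : R) (m : probability Sigma R)
    (h : R -> R) (mx : R.-pker (measurableTypeR R) ~> Sigma)
    (hbeta : 1 < beta < 2)
    (hm : bernoulli_half m)
    (hac : bernoulli_convolution beta m `<< lebesgue_measure)
    (hh : is_density (bernoulli_convolution beta m) h)
    (hh0 : forall x : R, ~ beta_interval beta x -> h x = 0)
    (hmx : is_disintegration beta m mx) :
  {ae bernoulli_convolution beta m, forall x : R,
    [/\ 0 < h x,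
        exists mu : probability Sigma R, is_density_fibre_measure beta h x mu
      & forall mu : probability Sigma R, is_density_fibre_measure beta h x mu ->
          forall A : set Sigma, measurable A -> mu A = mx x A]}.
Proof.
have /andP[beta1 _] := hbeta.
have [nu nuE] := bernoulli_convolution_probability beta beta1 m.
have h_gt0 := bernoulli_convolution_gt0 beta beta1 m h hh.
have supp := hmx.1.
have aeF := ae_filter_ringOfSetsType nu.
have dens w : {ae nu, forall x, beta_interval beta x ->
    (mx x (cylinder w) * (h x)%:E)%E =
    ((beta / 2) ^+ size w * h (beta_map_word beta w x))%:E}.
  have [N [mN N0 subN]] := disintegration_density beta beta1 m hm h hh mx hmx w.
  exists N; split => //.
  by have /null_content_dominatesP/(_ N mN N0) := hac; rewrite -nuE.
have densw : {ae nu, forall x w, beta_interval beta x ->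
    (mx x (cylinder w) * (h x)%:E)%E =
    ((beta / 2) ^+ size w * h (beta_map_word beta w x))%:E}.
  (* Almost-everywhere statements are closed under conjunctions over nat, so
     the words are enumerated through their codes. *)
  pose P n x := forall w, unpickle n = Some w -> beta_interval beta x ->
    (mx x (cylinder w) * (h x)%:E)%E =
    ((beta / 2) ^+ size w * h (beta_map_word beta w x))%:E.
  have aeP : {ae nu, forall x n, P n x}.
    apply: ae_foralln => n; rewrite /P; case: (unpickle n) => [v|]; last exact: aeW.
    by apply: filterS (dens v) => x + _ [<-].
  by apply: filterS aeP => x Px w; apply: (Px (pickle w)); rewrite pickleK.
rewrite /= -nuE in h_gt0 supp *.
apply: (@filterS3 _ _ aeF _ _ _ _ _ h_gt0 supp densw) => x hx mx1 mxw.
have xI : beta_interval beta x.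
  by apply: contrapT => /hh0 hx0; rewrite hx0 ltxx in hx.
have mxE w : mx x (cylinder w) =
    ((beta / 2) ^+ size w * (h (beta_map_word beta w x) / h x))%:E.
  have E := mxw w xI.
  by rewrite mulrA EFinM -E -muleA -EFinM divff ?mule1// gt_eqF.
split => //.
  have [P PE] := kernel_probability _ _ _ _ _ mx x; exists P.
  by split; [rewrite PE|move=> w; rewrite PE].
move=> mu [_ muE] A mA; apply: cylinder_measure_unique => //.
  by rewrite (le_lt_trans (probability_le1 mu measurableT))// ltry.
by move=> w; exact: etrans (muE w) (esym (mxE w)).
Qed.
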